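(* Let $k$ be an algebraically closed field and let $Q$ be a finite connected quiver without loops, i.e. the underlying non-oriented graph of $Q$ is simply connected (a tree). Let $\rho$ and $\rho'$ be exceptional representations of $Q$ over $k$ with thin dimension vectors. Then the linear map $F_{\rho,\rho'}$ has maximal rank.
   Context: $V(Q)$, $Arr(Q)$ are the vertices and arrows of $Q$; $s(a),t(a)$ are the origin and end of an arrow $a$. Representations are finite-dimensional. A representation $\rho$ is exceptional if $\mathrm{Hom}(\rho,\rho)=k$ and $\mathrm{Ext}^1(\rho,\rho)=0$. A vector $\alpha\in\mathbb N^{V(Q)}$ is thin if $\alpha_i=1$ for every $i$ in its support $\{i:\alpha_i\neq 0\}$. For representations $\rho,\rho'$ with dimension vectors $\alpha,\alpha'$, given by linear maps $\rho_a:k^{\alpha_{s(a)}}\to k^{\alpha_{t(a)}}$, $\rho'_a:k^{\alpha'_{s(a)}}\to k^{\alpha'_{t(a)}}$, the map $F_{\rho,\rho'}$ is $$F_{\rho,\rho'}:\prod_{i\in V(Q)}\mathrm{Hom}(k^{\alpha_i},k^{\alpha'_i})\to\prod_{a\in Arr(Q)}\mathrm{Hom}(k^{\alpha_{s(a)}},k^{\alpha'_{t(a)}}),\qquad \{f_i\}_{i}\mapsto\{f_{t(a)}\circ\rho_a-\rho'_a\circ f_{s(a)}\}_{a}.$$ A linear map has maximal rank if it is injective or surjective. *)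

(* Defs.v *)
From mathcomp Require Import all_boot all_algebra.

Set Implicit Arguments.
Unset Strict Implicit.
Unset Printing Implicit Defensive.

Import GRing.Theory.
Local Open Scope ring_scope.

Record quiver := Quiver {
  vertex : finType;
  arrow : finType;
  origin : arrow -> vertex;
  target : arrow -> vertex }.

Section UnderlyingGraph.

Variable Q : quiver.

Definition adjacent : rel (vertex Q) := fun i j =>
  [exists a : arrow Q, ((origin a == i) && (target a == j))
                       || ((origin a == j) && (target a == i))].

Definition connected_quiver : Prop :=
  (0 < #|vertex Q|)%N /\ forall i j : vertex Q, connect adjacent i j.

(* A step is an arrow together with the direction in which it is traversed:
   (a, true) along its orientation, (a, false) against it. *)
Definition step : finType := (arrow Q * bool)%type.
Definition step_from (e : step) : vertex Q :=
  if e.2 then origin e.1 else target e.1.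
Definition step_to (e : step) : vertex Q :=
  if e.2 then target e.1 else origin e.1.

(* Cycles of the underlying multigraph. Distinctness of the arrows excludes
   going back and forth along one arrow; an arrow from a vertex to itself is
   a cycle of length 1, two parallel or opposite arrows give one of length 2. *)
Definition graph_cycle (c : seq step) : Prop :=
  [/\ c != [::],
      cycle (fun e f => step_to e == step_from f) c,
      uniq (map step_from c)
    & uniq (map fst c)].

Definition tree_quiver : Prop :=
  connected_quiver /\ forall c : seq step, ~ graph_cycle c.

End UnderlyingGraph.

(* A d-dimensional space is k^d seen as column vectors; a linear map
   k^m -> k^n is an n x m matrix acting on the left. *)
Record rep (k : fieldType) (Q : quiver) := Rep {
  dimvec : vertex Q -> nat;
  rmap : forall a : arrow Q, 'M[k]_(dimvec (target a), dimvec (origin a)) }.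

Section Representations.

Variables (k : fieldType) (Q : quiver).
Implicit Types r : rep k Q.

Definition vertex_maps r r' : Type :=
  {dffun forall i : vertex Q, 'M[k]_(dimvec r' i, dimvec r i)}.
Definition arrow_maps r r' : Type :=
  {dffun forall a : arrow Q, 'M[k]_(dimvec r' (target a), dimvec r (origin a))}.

Definition Fmap r r' (f : vertex_maps r r') : arrow_maps r r' :=
  [ffun a : arrow Q =>
    (f (target a) *m rmap r a - rmap r' a *m f (origin a)
     : 'M[k]_(dimvec r' (target a), dimvec r (origin a)))].

Definition is_hom r r' (f : vertex_maps r r') : Prop :=
  forall a : arrow Q, f (target a) *m rmap r a = rmap r' a *m f (origin a).

(* Hom(r, r) = k: the map c |-> c * id from k to Hom(r, r) is bijective; its
   injectivity excludes the zero representation. *)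
Definition hom_scalar r : Prop :=
  forall f : vertex_maps r r, is_hom f ->
    exists! c : k, forall i : vertex Q, f i = c%:M.

(* 0 -> r' --f--> e --g--> r -> 0 *)
Definition short_exact r' (e : rep k Q) r
    (f : vertex_maps r' e) (g : vertex_maps e r) : Prop :=
  [/\ is_hom f,
      is_hom g
    & forall i : vertex Q,
      [/\ injective (fun x : 'cV[k]_(dimvec r' i) => f i *m x),
          forall y : 'cV[k]_(dimvec r i), exists x, g i *m x = y
        & forall x : 'cV[k]_(dimvec e i),
            g i *m x = 0 <-> exists y, f i *m y = x]].

(* Ext^1 is taken in the sense of Yoneda: Ext^1(r, r') is the set of
   equivalence classes of extensions of r by r', with the class of the split
   extensions as zero. *)
Definition ext1_zero r r' : Prop :=
  forall (e : rep k Q) (f : vertex_maps r' e) (g : vertex_maps e r),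
    short_exact f g ->
    exists h : vertex_maps r e,
      is_hom h /\ forall i : vertex Q, g i *m h i = 1%:M.

Definition exceptional r : Prop := hom_scalar r /\ ext1_zero r r.

End Representations.

Definition thin (Q : quiver) (alpha : vertex Q -> nat) : Prop :=
  forall i : vertex Q, alpha i != 0%N -> alpha i = 1%N.

Definition maximal_rank (U W : Type) (F : U -> W) : Prop :=
  injective F \/ (forall w : W, exists u : U, F u = w).

(* Main.v *)
Require Import Defs.
From mathcomp Require Import all_boot all_algebra.

(** Let A and B be the supports of the two representations. Testing
   Hom(rho, rho) = k against endomorphisms that are 0 or 1 at each vertex
   shows that A is connected and that every arrow inside A carries a nonzero
   map, and likewise for B ([hom_scalar_const], [hom_scalar_linked],
   [hom_scalar_rmap_neq0]). All spaces being lines or zero, F becomes a system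
   with one scalar unknown f_i per vertex i of A :&: B and one equation per
   arrow from A to B. An arrow inside A :&: B gives
   f_t * rho_a - rho'_a * f_s with both coefficients nonzero.

   In a forest the intersection A :&: B of two connected sets is connected
   ([linkedI]); suppose that it is not empty. An arrow from A to B then has at
   least one end in it, for otherwise it would close a cycle with a path in A
   and a path in B.

   If some arrow from A to B has exactly one end in A :&: B, its equation has
   a single term and forces f to vanish at that end; connectedness propagates
   the vanishing to all of A :&: B, and F is injective. If there is none, all
   equations live on arrows inside A :&: B. Each such equation determines the
   value at one end from the value at the other, and along a forest such
   transport rules can always be satisfied simultaneously ([forest_section]):
   F is surjective.

   Acyclicity enters only through cuts: removing an arrow a separates its two
   ends, so the set [beyond a] of vertices joined to the target of a without
   using a is a two-colouring of the vertices which is constant across every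
   other arrow and changes across a ([beyond_step], [beyond_cross]). This
   replaces arguments on paths by arguments on indicator functions, the same
   functions that define the idempotent endomorphisms above. *)

Set Implicit Arguments.
Unset Strict Implicit.
Unset Printing Implicit Defensive.

Import GRing.Theory.
Local Open Scope ring_scope.

(** * Cuts of a forest *)

Section Cuts.

Variable Q : quiver.
Implicit Types (a b : arrow Q) (u v : vertex Q) (e : step Q).

Definition adjacent_avoiding a : rel (vertex Q) := fun u v =>
  [exists e : step Q, [&& e.1 != a, step_from e == u & step_to e == v]].

Lemma adjacent_avoiding_sym a : symmetric (adjacent_avoiding a).
Proof.
suff imp u v : adjacent_avoiding a u v -> adjacent_avoiding a v u.
  by move=> u v; apply/idP/idP; apply: imp.
case/existsP=> -[b d] /and3P[/= ba /eqP <- /eqP <-].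
apply/existsP; exists (b, ~~ d); rewrite ba /step_from /step_to /=.
by case: d; rewrite /= !eqxx.
Qed.

Definition beyond a : pred (vertex Q) :=
  connect (adjacent_avoiding a) (target a).

Lemma beyond_step a e :
  e.1 != a -> beyond a (step_from e) = beyond a (step_to e).
Proof.
move=> ea; apply: same_connect_r.
  exact/sym_connect_sym/adjacent_avoiding_sym.
by apply: connect1; apply/existsP; exists e; rewrite ea !eqxx.
Qed.

(** The arrows of a simple walk are distinct, because a later step along the
   arrow of the first one would revisit the starting vertex, in whichever
   direction that arrow is traversed. *)
Lemma avoiding_walk a x p :
    path (adjacent_avoiding a) x p -> uniq (x :: p) ->
  exists es : seq (step Q),
    [/\ map (@step_from Q) es = belast x p, map (@step_to Q) es = p,
        uniq (map fst es), a \notin map fst es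
      & forall e0, step_to e0 = x ->
          path (fun e f => step_to e == step_from f) e0 es].
Proof.
elim: p x => [|y p IHp] x /=; first by move=> _ _; exists [::].
case/andP=> /existsP[e /and3P[ea /eqP eFx /eqP eTy]] yp /andP[xNyp uyp].
have [es [esF esT esU aNes esP]] := IHp _ yp uyp.
exists (e :: es); rewrite /= eFx eTy esF esT esU inE negb_or (eq_sym a) ea aNes.
split=> //; last by move=> e0 ->; rewrite eqxx esP.
rewrite andbT; apply: contra xNyp => /mapP[f f_es ef].
(* Both ends of f lie on the rest of the walk, and x is one of them. *)
have fF : step_from f \in y :: p.
  by apply: mem_belast; rewrite -esF map_f.
have fT : step_to f \in y :: p by rewrite inE -esT map_f ?orbT.
move: eFx fF fT; rewrite /step_from /step_to ef.
by case: (e.2); case: (f.2) => // ->.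
Qed.

Hypothesis acyclicQ : forall c : seq (step Q), ~ graph_cycle c.

(** A simple walk from the target of [a] back to its origin, closed up by [a]
   itself, would be a cycle. *)
Lemma beyond_origin a : ~~ beyond a (origin a).
Proof.
apply/negP=> /connectP[p0 p0P p0l]; case/shortenP: p0P p0l => p pP pU _ p_last.
have [es [esF esT esU aNes esP]] := avoiding_walk pP pU.
apply: (acyclicQ (c := (a, true) :: es)); split=> //.
- rewrite /= rcons_path esP //= -last_map esT.
  by rewrite /step_from /= /step_to /= -p_last eqxx.
- rewrite /= esF /step_from /= p_last.
  by rewrite -rcons_uniq -lastI.
- by rewrite /= aNes.
Qed.

Lemma beyond_cross e : beyond e.1 (step_from e) != beyond e.1 (step_to e).
Proof.
have t : beyond e.1 (target e.1) by apply: connect0.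
have := beyond_origin e.1; rewrite /step_from /step_to.
by case: (e.2); rewrite t; case: (beyond _ _).
Qed.

(** Connectedness of the subgraph induced on [A], in the form in which it is
   both obtained from endomorphism rings and used: locally constant functions
   are constant. The empty set is allowed. *)
Definition linked (A : pred (vertex Q)) : Prop :=
  forall D : pred (vertex Q),
    (forall a, A (origin a) -> A (target a) -> D (origin a) = D (target a)) ->
  forall i j, A i -> A j -> D i = D j.

(** A linked set that does not contain both ends of [a] is connected through
   the other arrows only, hence lies on one side of the cut at [a]. *)
Lemma linked_beyond (A : pred (vertex Q)) a i j : linked A ->
  ~~ (A (origin a) && A (target a)) -> A i -> A j -> beyond a i = beyond a j.
Proof.
move=> lA aNA; apply: lA => b bo bt.
apply: (@beyond_step a (b, true)); apply: contra aNA => /= /eqP <-.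
by rewrite bo.
Qed.

(** The piece of [B] on which [D] takes the value [D i] is enlarged to a set
   [D'] by adding, for each step leading from that piece out of [B], everything
   on the far side of the cut at that step. Since [B] lies entirely on the near
   side, nothing of [B] is added; and no arrow inside [A] has exactly one end
   in [D'], so [D'] contains [A]. *)
Lemma linkedI (A B : pred (vertex Q)) :
  linked A -> linked B -> linked (predI A B).
Proof.
move=> lA lB D Dconst i j /andP[Ai Bi] /andP[Aj Bj].
have Dstep e : A (step_from e) -> A (step_to e) -> B (step_from e) ->
    B (step_to e) -> D (step_from e) = D (step_to e).
  case: e => b []; rewrite /step_from /step_to /= => Ao At Bo Bt.
    by apply: Dconst; rewrite /= ?Ao ?At ?Bo ?Bt.
  by apply/esym/Dconst; rewrite /= ?Ao ?At ?Bo ?Bt.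
(* A step with an end outside B has all of B on the side of i. *)
have out e v : ~~ (B (step_from e) && B (step_to e)) -> B v ->
    beyond e.1 v = beyond e.1 i.
  move=> eNB Bv; apply: (linked_beyond lB) => //.
  by case: e eNB => b [] //=; rewrite andbC.
pose D' v := (B v && (D v == D i)) ||
  [exists e : step Q, [&& B (step_from e), ~~ B (step_to e),
     D (step_from e) == D i & beyond e.1 v != beyond e.1 i]].
have D'step e : A (step_from e) -> A (step_to e) ->
    D' (step_from e) -> D' (step_to e).
  move=> Au Av /orP[/andP[Bu Du]|/existsP[f /and4P[Bf BNf Df fu]]].
    have [Bv|BNv] := boolP (B (step_to e)).
      by rewrite /D' Bv -Dstep ?Du.
    apply/orP; right; apply/existsP; exists e; rewrite Bu BNv Du /=.
    rewrite -(out e (step_from e)) ?(negPf BNv) ?andbF // eq_sym.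
    exact: beyond_cross.
  (* Either e stays on the far side of the cut at f, or it crosses back to the
     end of f that lies in B. *)
  have [ef|ef] := eqVneq e.1 f.1; last first.
    apply/orP; right; apply/existsP; exists f.
    by rewrite Bf BNf Df -beyond_step.
  suff <- : step_from f = step_to e by rewrite /D' Bf Df.
  have : step_from f != step_from e.
    apply: contraNneq fu => <-; apply/eqP/out => //.
    by rewrite (negPf BNf) andbF.
  rewrite /step_from /step_to ef.
  by case: (e.2); case: (f.2) => //; rewrite eqxx.
have D'i : D' i by rewrite /D' Bi eqxx.
suff : D' j.
  case/orP=> [/andP[_ /eqP->//]|/existsP[f /and4P[_ BNf _]]].
  by rewrite out ?eqxx ?(negPf BNf) ?andbF.
rewrite (lA D' _ j i) // => a Ao At; apply/idP/idP.
  exact: (D'step (a, true)).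
exact: (D'step (a, false)).
Qed.

(** Add the arrows one at a time. A solution for the earlier arrows with the
   prescribed value at [r] is kept on the side of the cut at [a] that contains
   [r]; on the other side it is replaced by a second solution, whose value at
   the far end of [a] is chosen to fit the first. Prescribing the value at an
   arbitrary vertex is what makes the induction go through. *)
Lemma forest_section (X : Type) (R : arrow Q -> X -> X -> Prop) :
    (forall a x, exists y, R a x y) -> (forall a y, exists x, R a x y) ->
  forall (r : vertex Q) (x : X),
    exists f : vertex Q -> X,
      f r = x /\ forall a, R a (f (origin a)) (f (target a)).
Proof.
move=> Rl Rr r x.
suff [f [fr fR]] : exists f : vertex Q -> X, f r = x /\
    forall a, a \in enum (arrow Q) -> R a (f (origin a)) (f (target a)).
  by exists f; split=> // a; apply: fR; rewrite mem_enum.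
elim: (enum _) r x => [|a s IHs] r x; first by exists (fun=> x).
have [f [fr fR]] := IHs r x.
have glue (g : vertex Q -> X)
    (h := fun v => if beyond a v == beyond a r then f v else g v) :
    (forall b, b \in s -> R b (g (origin b)) (g (target b))) ->
    R a (h (origin a)) (h (target a)) ->
    exists f, f r = x /\
      forall b, b \in a :: s -> R b (f (origin b)) (f (target b)).
  move=> gR ha; exists h; split; first by rewrite /h eqxx.
  move=> b; rewrite inE; have [-> //|ba /= bs] := eqVneq b a.
  rewrite /h (@beyond_step a (b, true) ba) /step_to /=.
  by case: ifP => _; auto.
have t : beyond a (target a) by apply: connect0.
have o : beyond a (origin a) = false by apply/negbTE/beyond_origin.
case ra: (beyond a r).
  have [y ay] := Rr a (f (target a)); have [g [gy gR]] := IHs (origin a) y.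
  by apply: (glue g gR); rewrite t o ra /= gy.
have [y ay] := Rl a (f (origin a)); have [g [gy gR]] := IHs (target a) y.
by apply: (glue g gR); rewrite t o ra /= gy.
Qed.

End Cuts.

(** * Supports of representations with scalar endomorphisms *)

Lemma empty_mx_eq (T : Type) m n (M N : 'M[T]_(m, n)) :
  ~~ ((n != 0%N) && (m != 0%N)) -> M = N.
Proof.
case: m n M N => [|m] [|n] // M N _; first by apply/matrixP=> -[].
  by apply/matrixP=> -[].
by apply/matrixP=> i [].
Qed.

Section Supports.

Variables (k : fieldType) (Q : quiver).

Definition support (r : rep k Q) : pred (vertex Q) :=
  fun i => dimvec r i != 0%N.

(** The indicator of [D] is an endomorphism as soon as [D] does not separate
   the ends of an arrow with a nonzero map; being scalar, it is constant on the
   support. *)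
Lemma hom_scalar_const (r : rep k Q) (D : pred (vertex Q)) : hom_scalar r ->
    (forall a, rmap r a != 0 -> D (origin a) = D (target a)) ->
  forall i j, support r i -> support r j -> D i = D j.
Proof.
move=> hr Dconst.
pose f : vertex_maps r r := [ffun i => (D i)%:R%:M].
have [|c [fc _]] := hr f.
  move=> a; rewrite !ffunE mul_scalar_mx mul_mx_scalar.
  by have [->|/Dconst->//] := eqVneq (rmap r a) 0; rewrite !scaler0.
have Dc i : support r i -> (D i)%:R = c.
  rewrite /support -lt0n => i_gt0; have /matrixP := fc i; rewrite ffunE.
  by move=> /(_ (Ordinal i_gt0) (Ordinal i_gt0)); rewrite !mxE eqxx.
move=> i j /Dc Di /Dc; rewrite -Di.
by case: (D i); case: (D j) => // /eqP; rewrite ?oner_eq0 // eq_sym oner_eq0.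
Qed.

Lemma rmap_neq0_support (r : rep k Q) a :
  rmap r a != 0 -> support r (origin a) && support r (target a).
Proof.
by apply: contraNT => d0; apply/eqP/empty_mx_eq.
Qed.

Lemma hom_scalar_linked (r : rep k Q) : hom_scalar r -> linked (support r).
Proof.
move=> hr D Dconst; apply: hom_scalar_const hr _ => a.
by case/rmap_neq0_support/andP=> ? ?; apply: Dconst.
Qed.

(** If the map at [a] were zero, the indicator of one side of the cut at [a]
   would be a non-scalar endomorphism. *)
Lemma hom_scalar_rmap_neq0 (r : rep k Q) a :
    (forall c : seq (step Q), ~ graph_cycle c) -> hom_scalar r ->
  support r (origin a) -> support r (target a) -> rmap r a != 0.
Proof.
move=> acyclicQ hr ro rt; apply/eqP=> ra0.
have := beyond_cross acyclicQ (a, true); rewrite /step_from /step_to /=.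
rewrite (hom_scalar_const (D := beyond a) hr _ ro rt) ?eqxx // => b rb.
apply: (@beyond_step Q a (b, true)); apply: contraNneq rb => /= ->.
by rewrite ra0.
Qed.

End Supports.

(** * Matrices with at most one entry as scalars *)

Section SumOfEntries.

Variable k : fieldType.

(** On matrices with at most one row and one column this is the entry, or 0 if
   there is none. The dimensions of a thin representation are only provably,
   not definitionally, 0 or 1, and a sum over all indices needs no cast. *)
Definition mxsum m n (M : 'M[k]_(m, n)) : k := \sum_i \sum_j M i j.

Lemma mxsumB m n (M N : 'M[k]_(m, n)) : mxsum (M - N) = mxsum M - mxsum N.
Proof.
rewrite -sumrB; apply: eq_bigr => i _; rewrite -sumrB.
by apply: eq_bigr => j _; rewrite !mxE.
Qed.

Lemma mxsum0 m n : mxsum (0 : 'M[k]_(m, n)) = 0.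
Proof. by rewrite -(subr0 0) mxsumB subrr. Qed.

(** For an empty inner dimension both sides are 0, so bounding it by 1 is
   enough. *)
Lemma mxsumM m n p (M : 'M[k]_(m, n)) (N : 'M[k]_(n, p)) :
  (n <= 1)%N -> mxsum (M *m N) = mxsum M * mxsum N.
Proof.
rewrite /mxsum; case: n M N => [|[|//]] M N _.
  rewrite [X in _ = _ * X]big_ord0 mulr0 big1 // => i _.
  by rewrite big1 // => j _; rewrite mxE big_ord0.
rewrite big_ord1 mulr_suml; apply: eq_bigr => i _.
by rewrite big_ord1 mulr_sumr; apply: eq_bigr => j _; rewrite mxE big_ord1.
Qed.

Lemma mxsum_inj m n :
  (m <= 1)%N -> (n <= 1)%N -> injective (@mxsum m n).
Proof.
case: m n => [|[|//]] [|[|//]] _ _ M N; do ?by move=> _; apply: empty_mx_eq.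
rewrite /mxsum !big_ord1 => MN; apply/matrixP=> i j.
by rewrite !ord1.
Qed.

Lemma mxsum_const m n (x : k) : m = 1%N -> n = 1%N ->
  mxsum (const_mx x : 'M_(m, n)) = x.
Proof. by move=> -> ->; rewrite /mxsum !big_ord1 mxE. Qed.

End SumOfEntries.

(** * The map F of two thin representations *)

Lemma thin_le1 (k : fieldType) (Q : quiver) (r : rep k Q) i :
  thin (dimvec r) -> (dimvec r i <= 1)%N.
Proof. by move=> /(_ i); case: (dimvec r i) => // n ->. Qed.

Theorem lemma5p4 (k : closedFieldType) (Q : quiver) (hQ : tree_quiver Q)
    (rho rho' : rep k Q)
    (hrho : exceptional rho) (hrho' : exceptional rho')
    (thin_rho : thin (dimvec rho)) (thin_rho' : thin (dimvec rho')) :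
  maximal_rank (@Fmap k Q rho rho').
Proof.
have [_ acyclicQ] := hQ; have [hom_rho _] := hrho; have [hom_rho' _] := hrho'.
have lA := hom_scalar_linked hom_rho; have lB := hom_scalar_linked hom_rho'.
have lT := linkedI acyclicQ lA lB.
set A := support rho in lA lT; set B := support rho' in lB lT.
have leA i := thin_le1 i thin_rho; have leB i := thin_le1 i thin_rho'.
have rhoN0 a : A (origin a) -> A (target a) -> mxsum (rmap rho a) != 0.
  move=> Ao At; have := hom_scalar_rmap_neq0 acyclicQ hom_rho Ao At.
  by apply: contra_neq => r0; apply: mxsum_inj; rewrite // r0 mxsum0.
have rho'N0 a : B (origin a) -> B (target a) -> mxsum (rmap rho' a) != 0.
  move=> Bo Bt; have := hom_scalar_rmap_neq0 acyclicQ hom_rho' Bo Bt.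
  by apply: contra_neq => r0; apply: mxsum_inj; rewrite // r0 mxsum0.
have FE (u : vertex_maps rho rho') a : mxsum (Fmap u a) =
    mxsum (u (target a)) * mxsum (rmap rho a)
      - mxsum (rmap rho' a) * mxsum (u (origin a)).
  by rewrite ffunE mxsumB !mxsumM.
have entries0 i j (M N : 'M[k]_(dimvec rho' i, dimvec rho j)) :
    ~~ (A j && B i) -> M = N.
  exact: empty_mx_eq.
(* If the supports are disjoint, the source of F is zero. *)
have [/existsP[p Tp]|T0] := boolP [exists p, predI A B p]; last first.
  left=> u u' _; apply/ffunP=> i; apply: entries0.
  by apply: contraNN T0 => Ti; apply/existsP; exists i.
have [/existsP[a]|noexit] := boolP [exists a : arrow Q,
    [&& A (origin a), B (target a) & ~~ (B (origin a) && A (target a))]].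
- (* An arrow from A to B that is not inside the intersection: the difference
     of two vectors with the same image vanishes at one of its ends. *)
  case/and3P=> Ao Bt exit_a; left=> u u' Fuu'.
  pose D i := mxsum (u i) == mxsum (u' i).
  have Fa b : mxsum (u (target b)) * mxsum (rmap rho b)
      - mxsum (rmap rho' b) * mxsum (u (origin b)) =
      mxsum (u' (target b)) * mxsum (rmap rho b)
      - mxsum (rmap rho' b) * mxsum (u' (origin b)) by rewrite -!FE Fuu'.
  have DT i j : predI A B i -> predI A B j -> D i = D j.
    apply: lT => b /andP[/= bAo bBo] /andP[/= bAt bBt].
    have := Fa b; rewrite /D => Fb; apply/eqP/eqP=> E; move: Fb; rewrite E.
      by move/addIr/(mulIf (rhoN0 _ bAo bAt)).
    by move/addrI/oppr_inj/(mulfI (rho'N0 _ bBo bBt)).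
  have [q Tq Dq] : exists2 q, predI A B q & D q.
    have [Bo|BNo] := boolP (B (origin a)).
      exists (origin a); first by rewrite /= Ao.
      move: exit_a; rewrite Bo /= => ANt; have := Fa a.
      have -> : u (target a) = u' (target a).
        by apply: entries0; rewrite negb_and ANt.
      by move/addrI/oppr_inj/(mulfI (rho'N0 _ Bo Bt))/eqP.
    have [At|ANt] := boolP (A (target a)).
      exists (target a); first by rewrite /= At.
      have := Fa a; have -> : u (origin a) = u' (origin a).
        by apply: entries0; rewrite negb_and BNo orbT.
      by move/addIr/(mulIf (rhoN0 _ Ao At))/eqP.
    (* With neither end in the intersection, A and B would lie on opposite
       sides of the cut at a, although they share p. *)
    case/andP: Tp => Ap Bp; have := beyond_cross acyclicQ (a, true).
    rewrite /step_from /step_to /=.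
    rewrite (linked_beyond (A := A) lA (j := p)) ?(negPf ANt) ?andbF //.
    rewrite (linked_beyond (A := B) lB (i := p) (j := target a)) ?eqxx //.
    by rewrite (negPf BNo).
  apply/ffunP=> i; have [Ti|] := boolP (predI A B i); last exact: entries0.
  by apply: mxsum_inj => //; apply/eqP; rewrite -/(D i) (DT _ _ Ti Tq).
(* Every arrow from A to B is inside the intersection, so a solution of the
   scalar equations on those arrows is a preimage of w. The relation R is
   vacuous on the other arrows, and the value 0 at p is arbitrary. *)
right=> w.
pose inT a := predI A B (origin a) && predI A B (target a).
pose R a x y := inT a ->
  y * mxsum (rmap rho a) - mxsum (rmap rho' a) * x = mxsum (w a).
have [||f [_ fR]] := forest_section acyclicQ (R := R) _ _ p 0.
- move=> a x.
  exists ((mxsum (w a) + mxsum (rmap rho' a) * x) / mxsum (rmap rho a)).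
  case/andP=> /andP[/= Ao _] /andP[/= At _].
  by rewrite divfK ?addrK // rhoN0.
- move=> a y.
  exists ((y * mxsum (rmap rho a) - mxsum (w a)) / mxsum (rmap rho' a)).
  case/andP=> /andP[/= _ Bo] /andP[/= _ Bt].
  by rewrite [mxsum (rmap rho' a) * _]mulrC divfK ?rho'N0 // subKr.
exists [ffun i => const_mx (f i)]; apply/ffunP=> a.
have [/andP[Ao Bt]|] := boolP (A (origin a) && B (target a));
  last exact: entries0.
have /andP[Bo At] : B (origin a) && A (target a).
  apply: contraNT noexit => exit_a; apply/existsP; exists a.
  by rewrite Ao Bt exit_a.
apply: mxsum_inj => //; rewrite FE !ffunE !mxsum_const; try by auto.
by apply: fR; rewrite /inT /= Ao Bo At Bt.
Qed.
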